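(* Let $\kappa\ge\lambda\ge\omega$ be cardinals, $\mathrm{T}$ a theory and $\vdash$ the basic provability of $\mathscr L_{\kappa,\lambda}$, $\Theta$ a set of uniqueness formulas in $(\mathrm{T},\vdash)$, and $U$ a unary predicate symbol. Assume that (i) $\mathrm{T}\vdash\forall x\,(\theta(x)\to U(x))$ for all $\theta\in\Theta$, and (ii) for every atomic formula $\varphi$ in $n+1$ variables and $\theta_0,\ldots,\theta_n\in\Theta$, $\mathrm{T}\vdash\bar\varphi$ or $\mathrm{T}\vdash\neg\,\bar\varphi$, where $\bar\varphi$ is the sentence $\exists x_0\ldots\exists x_n\,(\varphi(x_0,\ldots,x_n)\wedge\theta_0(x_0)\wedge\ldots\wedge\theta_n(x_n))$. Then for every sentence $\sigma$ of $\mathscr L_{\kappa,\lambda}$, $\mathrm{T}\vdash^{U}_\Theta\sigma^{U}$ or $\mathrm{T}\vdash^{U}_\Theta\neg\,\sigma^{U}$, i.e., the theory $\{\sigma^U:\mathrm{T}\vdash^{U}_\Theta\sigma\}$ is a complete theory relativized to $U$.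
   Context: $\mathscr L_{\kappa,\lambda}$ is first-order infinitary logic with connectives of arity $<\kappa$ and quantifiers binding $<\lambda$ variables; $\exists_{\alpha<\gamma}x_\alpha$ and $\forall_{\alpha<\gamma}x_\alpha$ denote block quantifiers over the variable sequence $(x_\alpha)_{\alpha<\gamma}$. The basic provability is the standard Hilbert-style system (propositional axioms including $\bigwedge_{\alpha<\gamma}\varphi_\alpha\to\varphi_\beta$ and $\bigwedge_{\alpha<\gamma}(\varphi\to\varphi_\alpha)\to(\varphi\to\bigwedge_{\alpha<\gamma}\varphi_\alpha)$, quantifier and equality axioms, and the rules modus ponens, infinitary conjunction, and generalization $\varphi/\forall_{\alpha<\gamma}x_\alpha\,\varphi$). A formula $\theta(x)$ is a uniqueness formula in $(\mathrm{T},\vdash)$ iff $\mathrm{T}\vdash\exists x\,(\theta(x)\wedge\forall y\,(\theta(y)\to x=y))$. $\psi^U$ denotes the relativization of $\psi$ to $U$. The $(\Theta,U)$-restriction rule is the schema which, for each formula $\varphi$ in free variables $(x_\alpha)_{\alpha<\gamma}$, $\gamma<\lambda$, infers $\bigl(\forall_{\alpha<\gamma}x_\alpha\,\varphi(x_\alpha)_{\alpha<\gamma}\bigr)^U$ from the set of premises $\bigl\{\bigl(\exists_{\alpha<\gamma}x_\alpha\,(\bigwedge_{\alpha<\gamma}\theta_\alpha(x_\alpha)\wedge\varphi(x_\alpha)_{\alpha<\gamma})\bigr)^U:(\theta_\alpha)_{\alpha<\gamma}\in\Theta^\gamma\bigr\}$. $\vdash^U_\Theta$ is the provability generated by $\vdash$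 together with the $(\Theta,U)$-rule.
   Formalization: Added since the claim fails otherwise: T proves θ and θ^U equivalent on U for θ∈Θ; for infinite index sets of size <λ, T proves that elements satisfying the θ_i jointly exist; (ii) also covers atomic sentences (matters only for empty Θ). *)

(* Defs.v *)
(* MathComp world; cardinalities are those of mathcomp.classical. *)
From mathcomp Require Import all_boot.
From mathcomp Require Import boolp classical_sets functions cardinality.

Set Implicit Arguments.
Unset Strict Implicit.
Unset Printing Implicit Defensive.

Local Open Scope classical_set_scope.
Local Open Scope card_scope.

(* A cardinal is represented by a type of that cardinality, and a sequence
   indexed by an ordinal below the cardinal by a family over an arbitrary type
   of strictly smaller cardinality. *)
Definition small (K I : Type) : Prop :=
  [set: I] #<= [set: K] /\ ~ ([set: K] #<= [set: I]).

Record cardinals := Cardinals {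
  kappa : Type;
  lambda : Type;
  lambda_infinite : infinite_set [set: lambda];
  lambda_le_kappa : [set: lambda] #<= [set: kappa] }.

Lemma small_kappa (C : cardinals) (I : Type) :
  small (lambda C) I -> small (kappa C) I.
Proof.
move=> [IL nLI]; split; first exact: card_le_trans IL (lambda_le_kappa C).
by move=> KI; apply: nLI; apply: card_le_trans KI; exact: lambda_le_kappa.
Qed.

Lemma small_fin (C : cardinals) (I : finType) : small (lambda C) I.
Proof.
split; last first.
  by move=> LI; apply: (@lambda_infinite C); apply: card_le_finite LI _.
apply: card_le_trans (iffLR (infiniteP _) (@lambda_infinite C)).
exact/finite_set_countable/finite_finset.
Qed.

Record signature := Signature {
  fsym : Type;
  farity : fsym -> nat;
  rsym : Type;
  rarity : rsym -> nat }.

(* Terms and formulas are well scoped: [term S X] and [form C S X] are those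
   whose free variables belong to X. A quantifier block binds the variables
   [inr i], i : I, of the scope X + I. A sentence is a formula over [void]. *)
Inductive term (S : signature) (X : Type) : Type :=
| Var (x : X)
| App (f : fsym S) (ts : 'I_(farity f) -> term S X).
Arguments Var {S X} x.

Inductive form (C : cardinals) (S : signature) (X : Type) : Type :=
| Eq (t u : term S X)
| Rel (R : rsym S) (ts : 'I_(rarity R) -> term S X)
| Neg (phi : form C S X)
| Imp (phi psi : form C S X)
| Conj (I : Type) (hI : small (kappa C) I) (phi : I -> form C S X)
| All (I : Type) (hI : small (lambda C) I) (phi : form C S (X + I)).
Arguments Eq {C S X} t u.
Arguments Rel {C S X} R ts.

Definition atomic C S X (phi : form C S X) : Prop :=
  match phi with Eq _ _ | Rel _ _ => True | _ => False end.

Fixpoint tsubst S X Y (s : X -> term S Y) (t : term S X) : term S Y :=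
  match t with
  | Var x => s x
  | App f ts => App (fun i => tsubst s (ts i))
  end.

Definition lift S X Y (I : Type) (s : X -> term S Y) (v : X + I) :
    term S (Y + I) :=
  match v with
  | inl x => tsubst (fun y => Var (inl y)) (s x)
  | inr i => Var (inr i)
  end.

Fixpoint subst C S X Y (s : X -> term S Y) (phi : form C S X) : form C S Y :=
  match phi with
  | Eq t u => Eq (tsubst s t) (tsubst s u)
  | Rel R ts => Rel R (fun i => tsubst s (ts i))
  | Neg phi => Neg (subst s phi)
  | Imp phi psi => Imp (subst s phi) (subst s psi)
  | Conj J hJ phi => Conj hJ (fun i => subst s (phi i))
  | All J hJ phi => All hJ (subst (lift s) phi)
  end.

Definition rename C S X Y (f : X -> Y) : form C S X -> form C S Y :=
  subst (fun x => Var (f x)).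

Definition inst C S X I (t : I -> term S X) : form C S (X + I) -> form C S X :=
  subst (fun v => match v with inl x => Var x | inr i => t i end).

Definition Ex C S X I (hI : small (lambda C) I) (phi : form C S (X + I)) :
  form C S X := Neg (All hI (Neg phi)).

Definition And C S X (phi psi : form C S X) : form C S X :=
  Conj (small_kappa (small_fin C bool)) (fun b => if b then phi else psi).

Definition Iff C S X (phi psi : form C S X) : form C S X :=
  And (Imp phi psi) (Imp psi phi).

Definition All1 C S X (phi : form C S (X + unit)) : form C S X :=
  All (small_fin C unit) phi.

Definition Ex1 C S X (phi : form C S (X + unit)) : form C S X :=
  Ex (small_fin C unit) phi.

(* [at_ theta x] is theta(x), for theta with one free variable. *)
Definition at_ C S X (theta : form C S unit) (x : X) : form C S X :=
  rename (fun _ => x) theta.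

(* The conjunction of theta_i(x_i), i : I, about the innermost block x. *)
Definition ConjAt C S X I (hI : small (lambda C) I)
    (theta : I -> form C S unit) : form C S (X + I) :=
  Conj (small_kappa hI) (fun i => at_ (theta i) (inr i)).
Arguments ConjAt {C S X I} hI theta.

(* U(x); meant for U of arity 1. *)
Definition holds C S X (U : rsym S) (x : X) : form C S X :=
  Rel U (fun _ => Var x).

Fixpoint relativize C S (U : rsym S) X (phi : form C S X) : form C S X :=
  match phi with
  | Eq t u => Eq t u
  | Rel R ts => Rel R ts
  | Neg phi => Neg (relativize U phi)
  | Imp phi psi => Imp (relativize U phi) (relativize U psi)
  | Conj J hJ phi => Conj hJ (fun i => relativize U (phi i))
  | All J hJ phi =>
      All hJ (Imp (Conj (small_kappa hJ) (fun i => holds C U (inr i)))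
                  (relativize U phi))
  end.

Inductive axiom C S X : form C S X -> Prop :=
| ax_K phi psi : axiom (Imp phi (Imp psi phi))
| ax_S phi psi chi :
    axiom (Imp (Imp phi (Imp psi chi)) (Imp (Imp phi psi) (Imp phi chi)))
| ax_contra phi psi : axiom (Imp (Imp (Neg phi) (Neg psi)) (Imp psi phi))
| ax_conj_elim I (hI : small (kappa C) I) (phi : I -> form C S X) i :
    axiom (Imp (Conj hI phi) (phi i))
| ax_conj_intro I (hI : small (kappa C) I) phi (psi : I -> form C S X) :
    axiom (Imp (Conj hI (fun i => Imp phi (psi i))) (Imp phi (Conj hI psi)))
| ax_all_imp I (hI : small (lambda C) I) (phi : form C S X)
    (psi : form C S (X + I)) :
    axiom (Imp (All hI (Imp (rename inl phi) psi)) (Imp phi (All hI psi)))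
| ax_all_inst I (hI : small (lambda C) I) (phi : form C S (X + I))
    (t : I -> term S X) : axiom (Imp (All hI phi) (inst t phi))
| ax_eq_refl t : axiom (Eq t t)
| ax_eq_subst I (hI : small (lambda C) I) (phi : form C S (X + I))
    (t u : I -> term S X) :
    axiom (Imp (Conj (small_kappa hI) (fun i => Eq (t i) (u i)))
               (Imp (inst t phi) (inst u phi))).

(* Additional rules: [R P sigma] means that sigma may be inferred from the set
   P of premises. *)
Definition rule C S : Type :=
  (form C S void -> Prop) -> form C S void -> Prop.

(* Provability from T in the Hilbert calculus extended by the rules R. With
   named variables, a formula and its image under an injection of scopes are
   the same formula up to the names of its free variables; [prov_widen] and
   [prov_narrow] express this. For X = void, [prov_narrow] is where nonempty
   domains enter, as usual in a calculus whose derivations may use variables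
   not free in their conclusion. *)
Inductive prov C S (R : rule C S) (T : form C S void -> Prop) :
    forall X : Type, form C S X -> Prop :=
| prov_ax X (phi : form C S X) : axiom phi -> prov R T phi
| prov_hyp sigma : T sigma -> prov R T sigma
| prov_mp X (phi psi : form C S X) :
    prov R T (Imp phi psi) -> prov R T phi -> prov R T psi
| prov_conj X I (hI : small (kappa C) I) (phi : I -> form C S X) :
    (forall i, prov R T (phi i)) -> prov R T (Conj hI phi)
| prov_gen X I (hI : small (lambda C) I) (phi : form C S (X + I)) :
    prov R T phi -> prov R T (All hI phi)
| prov_widen X Y (f : X -> Y) (phi : form C S X) :
    injective f -> prov R T phi -> prov R T (rename f phi)
| prov_narrow X Y (f : X -> Y) (phi : form C S X) :
    injective f -> prov R T (rename f phi) -> prov R T phi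
| prov_rule (P : form C S void -> Prop) sigma :
    R P sigma -> (forall psi, P psi -> prov R T psi) -> prov R T sigma.

Definition basic C S (T : form C S void -> Prop) X (phi : form C S X) : Prop :=
  prov (fun _ _ => False) T phi.

Inductive restriction_rule C S (Theta : form C S unit -> Prop) (U : rsym S) :
    rule C S :=
| Restriction I (hI : small (lambda C) I) (phi : form C S (void + I)) :
    restriction_rule Theta U
      (fun psi => exists2 theta : I -> form C S unit,
         (forall i, Theta (theta i)) &
         psi = relativize U (Ex hI (And (ConjAt hI theta) phi)))
      (relativize U (All hI phi)).

Definition restricted C S (Theta : form C S unit -> Prop) (U : rsym S)
    (T : form C S void -> Prop) X (phi : form C S X) : Prop :=
  prov (restriction_rule Theta U) T phi.

Definition uniqueness C S (T : form C S void -> Prop) (theta : form C S unit) :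
    Prop :=
  basic T (X := void)
    (Ex1 (And (at_ theta (inr tt))
              (All1 (Imp (at_ theta (inr tt))
                         (Eq (Var (inl (inr tt))) (Var (inr tt))))))).

(* There exist x_0, ..., x_(n-1) with phi(x) and theta_i(x_i) for all i < n. *)
Definition bar C S n (phi : form C S (void + 'I_n))
    (theta : 'I_n -> form C S unit) : form C S void :=
  let hn := small_fin C 'I_n in Ex hn (And phi (ConjAt hn theta)).

(* Relativization to U does not affect theta on U. *)
Definition absolute C S (T : form C S void -> Prop) (U : rsym S)
    (theta : form C S unit) : Prop :=
  basic T (X := void)
    (All1 (Imp (holds C U (inr tt))
               (Iff (at_ theta (inr tt)) (at_ (relativize U theta) (inr tt))))).

(* Main.v *)
(* By induction on phi, if each free variable x of phi is assigned a uniqueness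
   formula theta_x in Theta, then the hypotheses theta_x(x) prove phi^U or its
   negation. Atomic formulas are settled by the hypothesis on their closures,
   as the theta_x determine the values of the variables. For a quantifier block
   (x_i), either some choice of theta_i refutes the body, and the universal
   formula fails because the theta_i are jointly satisfied in U; or every choice
   proves it. In the latter case the restriction rule is applied, over the block
   of all free and bound variables, to the implication from the theta_x(x) to
   the body. The rule also asks for the instances where the free variables
   satisfy other members of Theta. These hold as well: the equality instance of
   the hypothesis on atomic formulas shows that two members of Theta define
   provably equal or provably distinct elements. *)
Require Import Defs.
From Stdlib Require List.
From mathcomp Require Import all_boot.
From mathcomp Require Import boolp classical_sets functions cardinality.

Set Implicit Arguments.
Unset Strict Implicit.
Unset Printing Implicit Defensive.

(** * Cardinal arithmetic *)

Section Cardinality.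
Local Open Scope classical_set_scope.
Local Open Scope card_scope.

Lemma card_leTT (A B : Type) :
  [set: A] #<= [set: B] <-> exists f : A -> B, injective f.
Proof.
split=> [/card_leP[f]|[f f_inj]].
  exists (fun x => val (f (SigSub (mem_set (I : [set: A] x))))) => x y /val_inj.
  by move/(inj (mem_set I) (mem_set I)) => [].
elim/Ppointed: B => B in f f_inj *.
  have -> : [set: A] = set0 by apply/seteqP; split=> // a _; case: (no (f a)).
  exact: card_ge0.
by apply/pcard_injP; exists f => x y _ _ /f_inj.
Qed.

(** A maximal partial injection, taken as a graph, is total or onto: otherwise a pair of missed
    points could be added to it. *)
Lemma card_le_total (A B : Type) :
  [set: A] #<= [set: B] \/ [set: B] #<= [set: A].
Proof.
pose P (G : set (A * B)) :=
  (forall a b b', G (a, b) -> G (a, b') -> b = b') /\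
  (forall a a' b, G (a, b) -> G (a', b) -> a = a').
have [F FP Ftot|G [[Gfun Ginj] Gmax]] := @Zorn_bigcup _ P.
  by split=> x y z [X FX Xa] [Y FY Yb];
    have [XY|YX] := Ftot _ _ FX FY;
    have [fX iX] := FP _ FX; have [fY iY] := FP _ FY;
    [apply: (fY x)|apply: (fX x)|apply: (iY x y z)|apply: (iX x y z)]; auto.
have [Gtot|/existsNP[a nGa]] := pselect (forall a, exists b, G (a, b)).
  left; apply/card_leTT; have [f Gf] := choice Gtot.
  by exists f => x y fxy; apply: (Ginj x y (f x)) => //; rewrite fxy.
have [Gsur|/existsNP[b nGb]] := pselect (forall b, exists a, G (a, b)).
  right; apply/card_leTT; have [f Gf] := choice Gsur.
  by exists f => x y fxy; apply: (Gfun (f x)) => //; rewrite fxy.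
have [] := Gmax (G `|` [set (a, b)]).
  split; first by move=> x Gx; left.
  by move=> /(_ (a, b) (or_intror erefl)) Gab; apply: nGa; exists b.
split=> x y z [Gy|[-> ->]] [Gz|[]].
- exact: Gfun Gy Gz.
- by move=> ?; subst; case: nGa; exists y.
- by case: nGa; exists z.
- by move=> ->.
- exact: Ginj Gy Gz.
- by move=> ? ?; subst; case: nGb; exists x.
- by case: nGb; exists y.
- by move=> ->.
Qed.

Lemma infinite_nat_inj (T : Type) (A : set T) : infinite_set A ->
  exists e : nat -> T, injective e /\ forall n, A (e n).
Proof.
elim/Ppointed: T => T in A *.
  by case; have -> : A = set0 by apply/seteqP; split=> // a _; case: (no a).
move=> /infiniteP/ppcard_leP[e]; exists e; split=> [m n emn|n].
  exact: (inj (mem_set I) (mem_set I) emn).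
exact: funS.
Qed.

(* Zorn's lemma yields a maximal injection [D * bool -> D] with [D] in [A]. The
   complement of [D] is finite, otherwise the injection extends to a countably
   infinite part of it; and [A] embeds into [D] by moving the countable set
   consisting of this complement and the range of a sequence in [D] into the
   latter. *)
Lemma infinite_double (A : Type) : infinite_set [set: A] ->
  exists f : A * bool -> A, injective f.
Proof.
(* The last two clauses make the domain of [G] of the form [D * bool] and keep its values in [D]. *)
move=> A_inf; pose P (G : set (A * bool * A)) :=
  [/\ forall x c c', G (x, c) -> G (x, c') -> c = c',
      forall x x' c, G (x, c) -> G (x', c) -> x = x',
      forall a b c b', G ((a, b), c) -> exists c', G ((a, b'), c') &
      forall x c b, G (x, c) -> exists c', G ((c, b), c')].
have [F FP Ftot|G [[Gfun Ginj Gbool Gcl] Gmax]] := @Zorn_bigcup _ P.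
  split.
  - move=> x y z [X FX Xa] [Y FY Yb].
    have [XY|YX] := Ftot _ _ FX FY.
      by have [h _ _ _] := FP _ FY; apply: (h x) => //; exact: XY.
    by have [h _ _ _] := FP _ FX; apply: (h x) => //; exact: YX.
  - move=> x y z [X FX Xa] [Y FY Yb].
    have [XY|YX] := Ftot _ _ FX FY.
      by have [_ h _ _] := FP _ FY; apply: (h _ _ z) => //; exact: XY.
    by have [_ h _ _] := FP _ FX; apply: (h _ _ z) => //; exact: YX.
  - move=> a b c b' [X FX Xa]; have [_ _ h _] := FP _ FX.
    by have [c' ?] := h _ _ _ b' Xa; exists c'; exists X.
  - move=> x c b [X FX Xa]; have [_ _ _ h] := FP _ FX.
    by have [c' ?] := h _ _ b Xa; exists c'; exists X.
pose D := [set a | exists c, G ((a, true), c)].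
have DG a b : D a -> exists c, G ((a, b), c) by move=> [c /(Gbool a true c b)].
have GD a b c : G ((a, b), c) -> D a by move=> /(Gbool _ _ _ true).
have Dfin : finite_set (~` D).
  apply: contrapT => /infinite_nat_inj[e [e_inj eD]].
  (* The map from [(n, b)] to [2n + b] is a bijection of [nat * bool] with [nat], so the whole range
     of [e] can be added to [D]. *)
  pose E := [set p : A * bool * A |
    exists n b, p = ((e n, b), e (n.*2 + nat_of_bool b)%N)].
  have [] := Gmax (G `|` E).
    split; first by move=> p; left.
    move=> /(_ ((e 0, true), e 1)) GE; case: (eD 0); apply/GD/GE; right.
    by exists 0, true.
  split.
  - move=> x c c' [Gc|[n [b [-> ->]]]] [Gc'|[n' [b' [xe ->]]]].
    + exact: Gfun Gc Gc'.
    + by subst x; case: (eD n'); exact: GD Gc.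
    + by case: (eD n); exact: GD Gc'.
    + by case: xe => /e_inj -> ->.
  - move=> x x' c [Gx|[n [b [-> ->]]]] [Gx'|[n' [b' [-> xe]]]].
    + exact: Ginj Gx Gx'.
    + by case: (eD (n'.*2 + b')%N); rewrite -xe; exact: (Gcl _ _ true Gx).
    + by case: (eD (n.*2 + b)%N); exact: (Gcl _ _ true Gx').
    + move/e_inj: xe => nb.
      have bb : b = b'.
        by have := congr1 odd nb; rewrite !oddD !odd_double !oddb.
      have := congr1 half nb; rewrite bb.
      by rewrite addnC half_bit_double addnC half_bit_double => ->.
  - move=> a b c b' [/(Gbool _ _ _ b')[c' Gc']|[n [b'' [-> _ _]]]].
      by exists c'; left.
    by exists (e (n.*2 + b')%N); right; exists n, b'.
  - move=> x c b [/(Gcl _ _ b)[c' Gc']|[n [b'' [_ ->]]]].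
      by exists c'; left.
    by eexists; right; eexists; exists b.
have D_inf : infinite_set D.
  move=> Df; apply: A_inf; rewrite -(setvU D) finite_setU; split=> //.
have [g [g_inj gD]] := infinite_nat_inj D_inf.
pose M := ~` D `|` range g.
have /countable_injP[m m_inj] : countable M.
  rewrite /M -bigcup2E; apply: bigcup_countable => // -[|[|i]] _ //=.
    exact: finite_set_countable.
  exact/card_image_le.
pose h a := if pselect (M a) then g (m a) else a.
have hD a : D (h a).
  rewrite /h; case: pselect => [Ma|nM]; first exact: gD.
  by apply: contrapT => nD; case: (nM); left.
have h_inj : injective h.
  move=> a a'; rewrite /h; case: pselect => Ma; case: pselect => Ma' //.
  - by move/g_inj => /m_inj; apply; rewrite inE.
  - by move=> ga; case: (Ma'); right; exists (m a).
  - by move=> ga; case: (Ma); right; exists (m a').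
have [f fG] := choice (fun p : A * bool => DG (h p.1) p.2 (hD p.1)).
exists f => -[a b] [a' b'] ff; have := fG (a', b'); rewrite -ff.
by move=> /(Ginj _ _ _ (fG (a, b)))[/h_inj -> ->].
Qed.

(** Let [A] embed into [B]. If [B] is infinite, the sum embeds into [B * bool], hence into [B],
    which is too small for [K]; if [B] is finite, so is the sum. *)
Lemma small_sum (K A B : Type) : infinite_set [set: K] ->
  small K A -> small K B -> small K (A + B).
Proof.
move=> K_inf KA KB; suff nK : ~ ([set: K] #<= [set: (A + B)%type]).
  by split=> //; have [] := card_le_total (A + B) K.
wlog AB : A B KA KB / [set: A] #<= [set: B] => [hwlog|].
  have [|BA] := card_le_total A B; first exact: hwlog.
  move=> /card_leTT[f f_inj]; apply: (hwlog B A) => //; apply/card_leTT.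
  exists (fun x => match f x with inl a => inr a | inr b => inl b end) => x y.
  by case Ex: (f x) => [a|b]; case Ey: (f y) => [a'|b'] // [ab];
    apply: f_inj; rewrite Ex Ey ab.
have [B_fin|B_inf] := pselect (finite_set [set: B]).
  have A_fin := card_le_finite AB B_fin.
  move=> /card_le_finite; apply: contra_not K_inf; apply; last first.
  have -> : [set: (A + B)%type] = (inl @` setT) `|` (inr @` setT).
    by apply/seteqP; split=> // -[a|b] _; [left; exists a|right; exists b].
  by rewrite finite_setU; split; exact: finite_image.
move=> KAB; apply: KB.2; apply: (card_le_trans KAB); apply/card_leTT.
have [i i_inj] := (card_leTT A B).1 AB.
have [d d_inj] := infinite_double B_inf.
exists (fun x =>
  match x with inl a => d (i a, true) | inr b => d (b, false) end).
by move=> [a|b] [a'|b'] /d_inj [] // => [/i_inj|] ->.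
Qed.

End Cardinality.

(** * Substitution and relativization *)

Lemma tsubst_tsubst S X Y Z (s : X -> term S Y) (s' : Y -> term S Z)
    (t : term S X) :
  tsubst s' (tsubst s t) = tsubst (fun x => tsubst s' (s x)) t.
Proof. by elim: t => //= f ts IH; congr App; apply: funext. Qed.

Lemma tsubst_id S X (t : term S X) : tsubst Var t = t.
Proof. by elim: t => //= f ts IH; congr App; apply: funext. Qed.

Lemma subst_subst C S X Y Z (s : X -> term S Y) (s' : Y -> term S Z)
    (phi : form C S X) :
  subst s' (subst s phi) = subst (fun x => tsubst s' (s x)) phi.
Proof.
elim: phi Y Z s s' => {X} [X t u|X R ts|X a IHa|X a IHa b IHb|
  X I hI a IHa|X I hI a IHa] Y Z s s' /=.
- by rewrite !tsubst_tsubst.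
- by congr Rel; apply: funext => i; rewrite tsubst_tsubst.
- by rewrite IHa.
- by rewrite IHa IHb.
- by congr Conj; apply: funext => i; rewrite IHa.
- rewrite IHa; congr (All _ (subst _ _)); apply: funext => -[x|i] //=.
  by rewrite !tsubst_tsubst.
Qed.

Lemma lift_Var S X I : Defs.lift (@Var S X) = @Var S (X + I).
Proof. by apply: funext => -[]. Qed.

Lemma subst_id C S X (phi : form C S X) : subst Var phi = phi.
Proof.
elim: phi => {X} [X t u|X R ts|X a IHa|X a IHa b IHb|
  X I hI a IHa|X I hI a IHa] /=.
- by rewrite !tsubst_id.
- by congr Rel; apply: funext => i; rewrite tsubst_id.
- by rewrite IHa.
- by rewrite IHa IHb.
- by congr Conj; apply: funext => i; rewrite IHa.
- by rewrite lift_Var IHa.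
Qed.

Lemma subst_at C S X Y (s : X -> term S Y) (theta : form C S unit) x :
  subst s (at_ theta x) = subst (fun _ => s x) theta.
Proof. exact: subst_subst. Qed.

Lemma rename_at C S X Y (f : X -> Y) (theta : form C S unit) x :
  rename f (at_ theta x) = at_ theta (f x).
Proof. exact: subst_at. Qed.

(** The guards added by [relativize] mention only variables of the bound block, and [lift] fixes
    these. *)
Lemma relativize_subst C S (U : rsym S) X Y (s : X -> term S Y)
    (phi : form C S X) :
  relativize U (subst s phi) = subst s (relativize U phi).
Proof.
elim: phi Y s => {X} [X t u|X R ts|X a IHa|X a IHa b IHb|
  X I hI a IHa|X I hI a IHa] Y s //=.
- by rewrite IHa.
- by rewrite IHa IHb.
- by congr Conj; apply: funext => i; rewrite IHa.
- by rewrite IHa.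
Qed.

Lemma relativize_at C S (U : rsym S) X (theta : form C S unit) (x : X) :
  relativize U (at_ theta x) = at_ (relativize U theta) x.
Proof. exact: relativize_subst. Qed.

Lemma relativize_and C S (U : rsym S) X (phi psi : form C S X) :
  relativize U (And phi psi) = And (relativize U phi) (relativize U psi).
Proof. by congr Conj; apply: funext => -[]. Qed.

Lemma subst_and C S X Y (s : X -> term S Y) (phi psi : form C S X) :
  subst s (And phi psi) = And (subst s phi) (subst s psi).
Proof. by congr Conj; apply: funext => -[]. Qed.

(** * Natural deduction over the Hilbert calculus *)

Section NaturalDeduction.
Variables (C : cardinals) (S : signature).
Variables (R : rule C S) (T : form C S void -> Prop).
Implicit Types X Y : Type.

(** Generalization, change of scope and the rules [R] act only on provable formulas, through
    [nd_prov]. This restriction makes the deduction theorem hold for open hypotheses. *)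
Inductive nd X (l : seq (form C S X)) : form C S X -> Prop :=
| nd_prov phi : prov R T phi -> nd l phi
| nd_hyp phi : List.In phi l -> nd l phi
| nd_mp phi psi : nd l (Imp phi psi) -> nd l phi -> nd l psi
| nd_conj I (hI : small (kappa C) I) phi :
    (forall i, nd l (phi i)) -> nd l (Conj hI phi).

Lemma prov_nd X (phi : form C S X) : nd [::] phi -> prov R T phi.
Proof.
elim=> // {}phi; first by move=> psi _ h _ h'; exact: prov_mp h h'.
by move=> h f _ IH; exact: prov_conj.
Qed.

Lemma nd_axiom X (l : seq (form C S X)) phi : Defs.axiom phi -> nd l phi.
Proof. by move=> h; apply/nd_prov/prov_ax. Qed.

Lemma nd_cut X (l l' : seq (form C S X)) phi :
  (forall a, List.In a l -> nd l' a) -> nd l phi -> nd l' phi.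
Proof.
move=> ll'; elim=> {phi} [phi|phi /ll'//|phi psi _ + _|I hI phi _ IH].
- exact: nd_prov.
- exact: nd_mp.
- exact: nd_conj.
Qed.

Lemma nd_weak X (l l' : seq (form C S X)) phi :
  (forall a, List.In a l -> List.In a l') -> nd l phi -> nd l' phi.
Proof. by move=> ll'; apply: nd_cut => a /ll'; exact: nd_hyp. Qed.

Lemma nd_cons X (l : seq (form C S X)) a b : nd l b -> nd (a :: l) b.
Proof. by apply: nd_weak => c; right. Qed.

Lemma nd_head X (l : seq (form C S X)) a : nd (a :: l) a.
Proof. by apply: nd_hyp; left. Qed.

Lemma nd_K X (l : seq (form C S X)) a b : nd l b -> nd l (Imp a b).
Proof. by apply: nd_mp; apply: nd_axiom; exact: ax_K. Qed.

(** Deduction theorem. An infinitary conjunction is moved under the discharged hypothesis by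
    [ax_conj_intro]. *)
Lemma nd_imp X (l : seq (form C S X)) a b : nd (a :: l) b -> nd l (Imp a b).
Proof.
elim=> {b} [b h|b [->|h]|b c _ IHb _ IHc|I hI b _ IH].
- exact/nd_K/nd_prov.
- apply: nd_mp (nd_axiom _ (ax_K b b)).
  apply: nd_mp (nd_axiom _ (ax_K b (Imp b b))).
  exact/nd_axiom/ax_S.
- exact/nd_K/nd_hyp.
- by apply: nd_mp IHc; apply: nd_mp IHb; exact/nd_axiom/ax_S.
- by apply: nd_mp (nd_conj hI IH); exact/nd_axiom/ax_conj_intro.
Qed.

Lemma nd_absurd X (l : seq (form C S X)) a b : nd l a -> nd l (Neg a) -> nd l b.
Proof.
move=> la lna; apply: nd_mp la; apply: nd_mp; first exact/nd_axiom/ax_contra.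
exact: nd_K.
Qed.

Lemma nd_contra X (l : seq (form C S X)) a b :
  nd (Neg a :: l) b -> nd (Neg a :: l) (Neg b) -> nd l a.
Proof.
(* [Imp a a] serves as a provable formula whose negation follows from [Neg a]; contraposition then
   gives [a]. *)
move=> lb lnb; apply: (@nd_mp _ _ (Imp a a)); last exact/nd_imp/nd_head.
apply: nd_mp; first exact/nd_axiom/ax_contra.
by apply/nd_imp; exact: nd_absurd lb lnb.
Qed.

Lemma nd_neg X (l : seq (form C S X)) a b :
  nd (a :: l) b -> nd (a :: l) (Neg b) -> nd l (Neg a).
Proof.
move=> lb lnb; have na : nd (Neg (Neg a) :: l) a.
  by apply: (@nd_contra _ _ _ (Neg a)); [|apply: nd_cons]; exact: nd_head.
by apply: (@nd_contra _ _ _ b); apply: nd_mp na; apply/nd_cons/nd_imp.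
Qed.

Lemma nd_conjE X (l : seq (form C S X)) I (hI : small (kappa C) I) f i :
  nd l (Conj hI f) -> nd l (f i).
Proof. by apply: nd_mp; exact/nd_axiom/ax_conj_elim. Qed.

Lemma nd_and X (l : seq (form C S X)) a b : nd l a -> nd l b -> nd l (And a b).
Proof. by move=> la lb; apply: nd_conj => -[]. Qed.

Lemma nd_andl X (l : seq (form C S X)) a b : nd l (And a b) -> nd l a.
Proof. exact: (nd_conjE true). Qed.

Lemma nd_andr X (l : seq (form C S X)) a b : nd l (And a b) -> nd l b.
Proof. exact: (nd_conjE false). Qed.

Lemma nd_impE X (l : seq (form C S X)) a b : nd l (Imp a b) -> nd (a :: l) b.
Proof. by move=> /(@nd_cons _ _ a) /nd_mp; apply; exact: nd_head. Qed.

(** Packs the context into one formula, to which the rules for provable formulas apply; the head of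
    the list becomes the innermost premise. *)
Lemma nd_foldr X (l : seq (form C S X)) a :
  nd l a <-> prov R T (foldr (@Imp C S X) a (rev l)).
Proof.
split.
  move=> la; apply: prov_nd; elim: l a la => [|b l IH] a // /nd_imp/IH.
  by rewrite rev_cons foldr_rcons.
elim: l a => [|b l IH] a /=; first exact: nd_prov.
by rewrite rev_cons foldr_rcons => /IH /nd_impE.
Qed.

Lemma subst_foldr X Y (s : X -> term S Y) (l : seq (form C S X)) a :
  subst s (foldr (@Imp C S X) a (rev l)) =
  foldr (@Imp C S Y) (subst s a) (rev (map (subst s) l)).
Proof. by rewrite -map_rev; elim: (rev l) => //= b {}l ->. Qed.

Lemma nd_rename X Y (f : X -> Y) (l : seq (form C S X)) a : injective f ->
  nd l a -> nd (map (rename f) l) (rename f a).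
Proof.
move=> fI /nd_foldr h; apply/nd_foldr; rewrite -subst_foldr.
exact: prov_widen.
Qed.

(** Hypotheses renamed by [inl] cannot mention the new block, which is the eigenvariable condition;
    [ax_all_imp] moves the quantifier past them one by one. *)
Lemma nd_all X (l : seq (form C S X)) I (hI : small (lambda C) I) a :
  nd (map (rename inl) l) a -> nd l (All hI a).
Proof.
move=> /nd_foldr h.
have {h} : nd l
    (All hI (foldr (@Imp C S _) a (rev (map (rename inl) l)))).
  exact/nd_prov/prov_gen.
have : forall b, List.In b (rev l) -> nd l b.
  move=> b h; apply: nd_hyp; move: h; elim: (l) => //= c l' IH.
  rewrite rev_cons -cats1 => /(List.in_app_or (rev l') [:: c]).
  by move=> [/IH|[|[]]]; auto.
rewrite -map_rev; elim: (rev l) => //= b l' IH lb lA; apply: IH.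
  by move=> c ?; apply: lb; right.
by apply: nd_mp (lb b _); [apply: nd_mp lA; exact/nd_axiom/ax_all_imp|left].
Qed.

Lemma nd_allE X (l : seq (form C S X)) I (hI : small (lambda C) I) a t :
  nd l (All hI a) -> nd l (inst t a).
Proof. by apply: nd_mp; exact/nd_axiom/ax_all_inst. Qed.

Lemma nd_exE X (l : seq (form C S X)) I (hI : small (lambda C) I) a b :
  nd l (Ex hI a) -> nd (a :: map (rename inl) l) (rename inl b) -> nd l b.
Proof.
move=> lE lb; apply: nd_contra (nd_cons _ lE); apply: nd_all => /=.
apply: (@nd_neg _ _ _ (rename inl b)).
  by apply: nd_weak lb => c /= []; auto.
by apply: nd_hyp => /=; auto.
Qed.

(* Generalize over a copy of the scope X, then instantiate it; generalization
   is what requires X to be small. *)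
Lemma nd_subst X Y (hX : small (lambda C) X) (s : X -> term S Y)
    (l : seq (form C S X)) a : nd l a -> nd (map (subst s) l) (subst s a).
Proof.
move=> /nd_foldr h; apply/nd_foldr; rewrite -subst_foldr.
have /(prov_gen hX) {}h :
    prov R T (rename (@inr Y X) (foldr (@Imp C S X) a (rev l))).
  by apply: prov_widen h => x y [].
have -> : subst s (foldr (@Imp C S X) a (rev l)) =
    inst s (rename inr (foldr (@Imp C S X) a (rev l))).
  by rewrite /inst /rename subst_subst.
apply: prov_mp h; exact/prov_ax/ax_all_inst.
Qed.

Lemma nd_eq_subst X (l : seq (form C S X)) I (hI : small (lambda C) I) a
    (t u : I -> term S X) :
  (forall i, nd l (Eq (t i) (u i))) -> nd l (inst t a) -> nd l (inst u a).
Proof.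
move=> /(nd_conj (small_kappa hI)) h; apply: nd_mp; apply: nd_mp h.
exact/nd_axiom/ax_eq_subst.
Qed.

Lemma nd_eq_sym X (l : seq (form C S X)) t u : nd l (Eq t u) -> nd l (Eq u t).
Proof.
move=> tu.
(* The variable [inr tt] marks the place to be replaced: the instance at [t] is reflexivity, the one
   at [u] is the claim. *)
have := @nd_eq_subst _ l unit (small_fin C unit)
  (Eq (Var (inr tt)) (tsubst (fun x => Var (inl x)) t))
  (fun _ => t) (fun _ => u) (fun _ => tu).
rewrite /inst /= !tsubst_tsubst /= tsubst_id; apply.
exact/nd_axiom/ax_eq_refl.
Qed.

Lemma nd_eq_trans X (l : seq (form C S X)) t u v :
  nd l (Eq t u) -> nd l (Eq u v) -> nd l (Eq t v).
Proof.
move=> tu uv.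
have := @nd_eq_subst _ l unit (small_fin C unit)
  (Eq (tsubst (fun x => Var (inl x)) t) (Var (inr tt)))
  (fun _ => u) (fun _ => v) (fun _ => uv).
by rewrite /inst /= !tsubst_tsubst /= tsubst_id; apply.
Qed.

Lemma prov_sub (R' : rule C S) X (phi : form C S X) :
  (forall P sigma, R P sigma -> R' P sigma) ->
  prov R T phi -> prov R' T phi.
Proof.
move=> RR'; elim=> {X phi}.
- by move=> X phi; exact: prov_ax.
- by move=> sigma; exact: prov_hyp.
- by move=> X phi psi _ + _; exact: prov_mp.
- by move=> X I hI phi _; exact: prov_conj.
- by move=> X I hI phi _; exact: prov_gen.
- by move=> X Y f phi fI _; exact: prov_widen.
- by move=> X Y f phi fI _; exact: prov_narrow.
- by move=> P sigma /RR' h _; exact: prov_rule.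
Qed.

End NaturalDeduction.

Arguments nd_head {C S R T X l a}.
Arguments nd_neg {C S R T X l a} b.
Arguments nd_conjE {C S R T X l I hI f} i.

(** * Finite support of atomic formulas *)

Definition fin_supported S X (t : term S X) : Prop :=
  exists n (t' : term S 'I_n) (g : 'I_n -> X),
    t = tsubst (fun i => Var (g i)) t'.

Lemma fin_supported_family S X k (ts : 'I_k -> term S X) :
  (forall i, fin_supported (ts i)) ->
  exists n (ts' : 'I_k -> term S 'I_n) (g : 'I_n -> X),
    ts = fun i => tsubst (fun j => Var (g j)) (ts' i).
Proof.
move=> /choice[n /(_ _)/cid-/all_sig[t' /(_ _)/cid-/all_sig[g tE]]].
(* The common support is the disjoint union of the supports; several of its indices may be sent to
   one variable of [X]. *)
pose F : finType := {i : 'I_k & 'I_(n i)}.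
pose inF i (j : 'I_(n i)) : F := Tagged (fun i => 'I_(n i)) j.
exists #|F|, (fun i => tsubst (fun j => Var (enum_rank (inF i j))) (t' i)).
exists (fun j => g (tag (enum_val j : F)) (tagged (enum_val j : F))).
apply: funext => i; rewrite tsubst_tsubst {1}tE; congr (tsubst _ _).
by apply: funext => j; rewrite /= enum_rankK.
Qed.

Lemma fin_supportedT S X (t : term S X) : fin_supported t.
Proof.
elim: t => [x|f ts /fin_supported_family[n [ts' [g ->]]]].
  by exists 1, (Var ord0), (fun _ => x).
by exists n, (App ts'), g.
Qed.

(** Formulas over [void + I] are the bodies of closed block quantifiers; [block t] is used to
    instantiate such a body in any scope. *)
Definition block S X I (t : I -> term S X) (v : void + I) : term S X :=
  match v with inl v => of_void _ v | inr i => t i end.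

Lemma atomic_fin_supported C S X (phi : form C S X) : atomic phi ->
  exists n (phi' : form C S (void + 'I_n)) (g : 'I_n -> X),
    atomic phi' /\ phi = subst (block (fun i => Var (g i))) phi'.
Proof.
case: phi => // [t u|R ts] _.
  (* An equation is treated like a binary relation, so that both sides get a common support. *)
  pose tu (i : 'I_2) := if i == ord0 then t else u.
  have [n [ts' [g tsE]]] :=
    fin_supported_family (fun i => fin_supportedT (tu i)).
  exists n, (Eq (tsubst (fun i => Var (inr i)) (ts' ord0))
                (tsubst (fun i => Var (inr i)) (ts' ord_max))), g.
  split=> //=; rewrite !tsubst_tsubst.
  congr Eq; first exact: (congr1 (@^~ ord0) tsE).
  exact: (congr1 (@^~ ord_max) tsE).
have [n [ts' [g ->]]] := fin_supported_family (fun i => fin_supportedT (ts i)).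
exists n, (Rel R (fun i => tsubst (fun i => Var (inr i)) (ts' i))), g.
split=> //=; congr Rel; apply: funext => i.
by rewrite tsubst_tsubst.
Qed.

(** * Closed theorems used inside open contexts *)

Section Closed.
Variables (C : cardinals) (S : signature).
Variables (R : rule C S) (T : form C S void -> Prop).
Local Notation nd := (nd R T).

Lemma nd_inl X I (l : seq (form C S X)) a :
  nd l a -> nd (map (rename (@inl X I)) l) (rename inl a).
Proof. by apply: nd_rename => x y []. Qed.

Lemma nd_allE_inl X I (l : seq (form C S (X + I))) (hI : small (lambda C) I) a :
  nd l (rename inl (All hI a)) -> nd l a.
Proof.
move=> /(nd_allE (fun i => Var (inr i))); rewrite /inst subst_subst.
rewrite -[X in _ -> nd l X]subst_id; congr (nd _ (subst _ _)).
by apply: funext => -[].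
Qed.

Lemma nd_closed X (l : seq (form C S X)) (phi : form C S void) :
  prov R T phi -> nd l (subst (of_void _) phi).
Proof.
move=> h; apply: nd_prov.
(* A substitution out of [void] is vacuously an injective renaming, as widening requires. *)
have -> : of_void (term S X) = (fun v => Var (of_void X v)).
  by apply: funext => -[].
by apply: prov_widen h => -[].
Qed.

Lemma nd_closed_all X (l : seq (form C S X)) I (hI : small (lambda C) I) phi t :
  prov R T (X := void) (All hI phi) -> nd l (subst (block t) phi).
Proof.
move=> /(nd_closed l) /= /(nd_allE t); rewrite /inst subst_subst.
by congr (nd _ (subst _ _)); apply: funext => -[[]|].
Qed.

Lemma nd_closed_exI X (l : seq (form C S X)) I (hI : small (lambda C) I) phi t :
  nd l (subst (block t) phi) ->
  nd l (subst (of_void _) (Ex hI phi)).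
Proof.
move=> lphi; apply: nd_neg; first exact: nd_cons lphi.
have := nd_allE t (@nd_head _ _ R T _ l
  (subst (of_void _) (All hI (Neg phi)))).
rewrite /inst /= subst_subst; congr (nd _ (Neg (subst _ _))).
by apply: funext => -[[]|].
Qed.

Lemma nd_closed_exE X (l : seq (form C S X)) I (hI : small (lambda C) I) phi b :
  prov R T (X := void) (Ex hI phi) ->
  nd (subst (block (fun i => Var (inr i))) phi :: map (rename inl) l)
     (rename inl b) -> nd l b.
Proof.
move=> /(nd_closed l) /= /nd_exE h h'; apply: h; move: h'.
by congr (nd (subst _ _ :: _) _); apply: funext => -[[]|].
Qed.

End Closed.

Arguments nd_closed_exI {C S R T X l I hI phi} t.

(** * Uniqueness formulas and completeness *)

Section Completeness.
Variables (C : cardinals) (S : signature) (T : form C S void -> Prop).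
Variables (Theta : form C S unit -> Prop) (U : rsym S).
Hypothesis unique : forall theta, Theta theta -> uniqueness T theta.
Hypothesis in_U : forall theta, Theta theta ->
  basic T (X := void) (All1 (Imp (at_ theta (inr tt)) (holds C U (inr tt)))).
Hypothesis decided : forall n (phi : form C S (void + 'I_n)), atomic phi ->
  forall theta : 'I_n -> form C S unit, (forall i, Theta (theta i)) ->
  basic T (bar phi theta) \/ basic T (Neg (bar phi theta)).
(** The premises of the restriction rule contain the formulas of [Theta] relativized, the other
    hypotheses contain them as they are; absoluteness passes between the two. *)
Hypothesis theta_absolute : forall theta, Theta theta -> absolute T U theta.
(** Finitely many witnesses can be introduced one after another, as in [nd_joint_fin]; for an
    infinite block this hypothesis supplies them all at once. *)
Hypothesis joint_existence : forall (I : Type) (hI : small (lambda C) I),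
  infinite_set [set: I]%classic ->
  forall theta : I -> form C S unit, (forall i, Theta (theta i)) ->
  basic T (X := void) (Ex hI (ConjAt hI theta)).
Local Notation R := (restriction_rule Theta U).
Local Notation nd := (nd R T).

(** * Elements defined by formulas of [Theta] *)

Lemma basic_prov X (phi : form C S X) : basic T phi -> prov R T phi.
Proof. exact: prov_sub. Qed.

Lemma nd_in_U X (l : seq (form C S X)) theta x :
  Theta theta -> nd l (at_ theta x) -> nd l (holds C U x).
Proof.
move=> /in_U/basic_prov/(nd_closed_all l (fun=> Var x)) /=.
by rewrite subst_at; exact: nd_mp.
Qed.

Lemma nd_absolute X (l : seq (form C S X)) theta x :
  Theta theta -> nd l (holds C U x) ->
  nd l (at_ theta x) <-> nd l (at_ (relativize U theta) x).
Proof.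
move=> /theta_absolute/basic_prov/(nd_closed_all l (fun=> Var x)) /=.
move=> h Ux; have {}h := nd_mp h Ux.
have := nd_conjE true h; have := nd_conjE false h; rewrite /= !subst_at.
by split; exact: nd_mp.
Qed.

Lemma nd_ex_one X (l : seq (form C S X)) theta b : Theta theta ->
  nd (at_ theta (inr tt) :: map (rename inl) l) (rename inl b) -> nd l b.
Proof.
move=> /unique/basic_prov/nd_closed_exE h h'; apply: h.
rewrite subst_and subst_at; apply: nd_cut h' => a /= [<-|al].
  exact/nd_andl/nd_head.
by apply: nd_hyp; right.
Qed.

(** Both variables equal the unique element, introduced as the fresh variable [inr tt]. *)
Lemma nd_unique X (l : seq (form C S X)) theta x y : Theta theta ->
  nd l (at_ theta x) -> nd l (at_ theta y) -> nd l (Eq (Var x) (Var y)).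
Proof.
move=> /unique/basic_prov/nd_closed_exE h lx ly; apply: h.
rewrite subst_and subst_at /=; set a := All _ _; set e := And _ _.
have z_eq v : nd l (at_ theta v) ->
    nd (e :: map (rename inl) l) (Eq (Var (inr tt)) (Var (inl v))).
  move=> /(nd_inl unit)/(@nd_cons _ _ _ _ _ _ e) lv.
  have la : nd (e :: map (rename inl) l) a by exact/nd_andr/nd_head.
  have := nd_allE (fun=> Var (inl v)) la.
  rewrite /inst /= !subst_at /= => /nd_mp; apply.
  by move: lv; rewrite rename_at.
exact: nd_eq_trans (nd_eq_sym (z_eq x lx)) (z_eq y ly).
Qed.

(** The decided closure fixes the verdict before any context is given, so one alternative holds
    uniformly in [Y], [l] and [f]. *)
Lemma nd_atomic n (phi : form C S (void + 'I_n))
    (theta : 'I_n -> form C S unit) :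
  atomic phi -> (forall i, Theta (theta i)) ->
  (forall Y (l : seq (form C S Y)) f, (forall i, nd l (at_ (theta i) (f i))) ->
     nd l (subst (block (fun i => Var (f i))) phi)) \/
  (forall Y (l : seq (form C S Y)) f, (forall i, nd l (at_ (theta i) (f i))) ->
     nd l (Neg (subst (block (fun i => Var (f i))) phi))).
Proof.
move=> phi_at Th; case: (decided phi_at Th) => /basic_prov h;
  [left|right] => Y l f lf.
  apply: nd_closed_exE h _; rewrite subst_and; set e := And _ _.
  have le : nd (e :: map (rename inl) l) e by exact: nd_head.
  (* By uniqueness the witnesses of the closure equal the given [f i], and [phi] is carried along
     these equations. *)
  have := @nd_eq_subst _ _ R T _ (e :: map (rename inl) l)
    'I_n (small_fin C 'I_n)
    (subst (block (fun i => Var (inr i))) phi) (fun i => Var (inr i))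
    (fun i => Var (inl (f i))).
  rewrite /inst /rename !subst_subst => eq_subst.
  have -> : (fun x =>
          tsubst (fun y => Var (inl y)) (block (fun i => Var (f i)) x)) =
      (fun x : void + 'I_n => tsubst
          (fun v => match v with inl x => Var x | inr i => Var (inl (f i)) end)
          (block (fun i => Var (inr i)) x)) :> (_ -> term S (Y + 'I_n)).
    by apply: funext => -[[]|].
  apply: eq_subst => [i|].
    apply: (nd_unique (Th i)).
      have : nd (e :: map (rename inl) l)
          (subst (block (fun i => Var (inr i))) (at_ (theta i) (inr i))).
        exact: (nd_conjE i (nd_andr le)).
      by rewrite subst_at.
    by have := nd_cons e (nd_inl _ (lf i)); rewrite rename_at.
  move: (nd_andl le); congr (nd _ (subst _ _)).
  by apply: funext => -[[]|].
(* If [phi] held at the [f i], they would witness the refuted closure. *)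
apply: (nd_neg
  (subst (of_void _) (bar phi theta))).
  apply: (nd_closed_exI (fun i => Var (f i))).
  rewrite subst_and; apply: nd_and; first exact: nd_head.
  apply: nd_conj => i; have : nd (subst (block (fun i => Var (f i))) phi :: l)
      (subst (block (fun i => Var (f i))) (at_ (theta i) (inr i))).
    by rewrite subst_at; exact: nd_cons (lf i).
  exact: id.
exact: nd_cons (nd_closed l h).
Qed.

(** The equation between the elements defined by [theta] and [theta'] is atomic, hence decided. *)
Lemma nd_compare theta theta' : Theta theta -> Theta theta' ->
  (forall X (l : seq (form C S X)) x,
     nd l (at_ theta' x) -> nd l (at_ theta x)) \/
  (forall X (l : seq (form C S X)) x,
     nd l (at_ theta' x) -> nd l (Neg (at_ theta x))).
Proof.
move=> Th Th'; pose thetas (i : 'I_2) := if i == ord0 then theta else theta'.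
have Ths i : Theta (thetas i) by rewrite /thetas; case: ifP.
have [h|h] := @nd_atomic 2 (Eq (Var (inr ord0)) (Var (inr ord_max)))
  thetas Logic.I Ths.
  left=> X l x lx; apply: (nd_ex_one Th); set e := at_ _ _.
  have le : nd (e :: map (rename inl) l) e by exact: nd_head.
  have lx' : nd (e :: map (rename inl) l) (at_ theta' (inl x)).
    by have := nd_cons e (nd_inl unit lx); rewrite rename_at.
  have := h _ (e :: map (rename inl) l)
    (fun i => if i == ord0 then inr tt else inl x).
  rewrite /= => {}h.
  have {}h : nd (e :: map (rename inl) l) (Eq (Var (inr tt)) (Var (inl x))).
    by apply: h => i; rewrite /thetas; case: ifP.
  have := @nd_eq_subst _ _ R T _ (e :: map (rename inl) l)
    unit (small_fin C unit) (at_ theta (inr tt))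
    (fun=> Var (inr tt)) (fun=> Var (inl x)) (fun=> h).
  by rewrite /inst !subst_at rename_at; apply.
(* An element satisfying both formulas would be distinct from itself. *)
right=> X l x lx; apply: (nd_neg (Eq (Var x) (Var x))).
  exact/nd_axiom/ax_eq_refl.
have := h _ (at_ theta x :: l) (fun=> x); rewrite /=; apply=> i.
by rewrite /thetas; case: ifP => _; [exact: nd_head|exact: nd_cons].
Qed.

(* Elements satisfying the theta i are introduced one at a time, in the order of
   decreasing h i; n bounds the number still missing. *)
Lemma nd_joint_fin I (hI : small (lambda C) I) theta (h : I -> nat) X
    (l : seq (form C S X)) n :
  injective h -> (forall i, Theta (theta i)) ->
  (forall i, (n <= h i)%N -> exists y : X, nd l (at_ (theta i) y)) ->
  nd l (subst (of_void _) (Ex hI (ConjAt hI theta))).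
Proof.
move=> h_inj Th; elim: n X l => [|n IH] X l ln.
  have /choice[t lt] : forall i, exists y : X, nd l (at_ (theta i) y).
    by move=> i; exact: ln.
  apply: (nd_closed_exI (fun i => Var (t i))).
  apply: nd_conj => i; have := lt i.
  suff -> : at_ (theta i) (t i) =
      subst (block (fun i => Var (t i))) (at_ (theta i) (inr i)) by [].
  by rewrite subst_at.
have [[i hi]|no_i] := pselect (exists i, h i = n); last first.
  apply: IH => i; rewrite leq_eqVlt => /orP[/eqP hi|]; last exact: ln.
  by case: no_i; exists i.
apply: (nd_ex_one (Th i)); rewrite /rename subst_subst.
set s := fun v : void => _.
have -> : s = of_void (term S (X + unit)).
  by apply: funext => -[].
apply: IH => j; rewrite leq_eqVlt => /orP[/eqP hj|/ln[y ly]].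
  exists (inr tt); have -> : j = i by apply: h_inj; rewrite hi.
  exact: nd_head.
exists (inl y); apply: nd_cons.
by have := nd_inl unit ly; rewrite rename_at.
Qed.

Lemma prov_joint I (hI : small (lambda C) I) theta :
  (forall i, Theta (theta i)) -> prov R T (X := void) (Ex hI (ConjAt hI theta)).
Proof.
move=> Th; have [I_fin|I_inf] := pselect (finite_set [set: I]); last first.
  exact/basic_prov/joint_existence.
(* All values of [h] lie below [n], so the last premise of [nd_joint_fin] holds vacuously at the
   start. *)
have [n /pcard_leP[h]] := (finite_set_leP _).1 I_fin.
have h_inj : injective h.
  by move=> x y /(inj (mem_set Logic.I) (mem_set Logic.I)).
have hn i : (h i < n)%N by exact: (@funS _ _ _ _ h i Logic.I).
have := @nd_joint_fin _ hI theta h void [::] n h_inj Th.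
have -> : of_void (term S void) = Var.
  by apply: funext => -[].
by rewrite subst_id => h'; apply/prov_nd/h' => i; rewrite leqNgt hn.
Qed.

Lemma nd_joint X (l : seq (form C S X)) I (hI : small (lambda C) I)
    (theta : I -> form C S unit) b :
  (forall i, Theta (theta i)) ->
  (forall l', (forall a, List.In a l -> List.In (rename inl a) l') ->
     (forall i, nd l' (at_ (theta i) (inr i))) -> nd l' (rename inl b)) ->
  nd l b.
Proof.
move=> Th h; apply: (nd_closed_exE (prov_joint hI Th)); apply: h => [a al|i].
  by right; exact: List.in_map.
set e := subst _ _; have le : nd (e :: map (rename inl) l) e by exact: nd_head.
have : nd (e :: map (rename inl) l)
  (subst (block (fun i => Var (inr i))) (at_ (theta i) (inr i))).
  exact: (nd_conjE i le).
by rewrite subst_at.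
Qed.

(** * Decision of relativized formulas *)

(** Contexts are finite lists while [X] may be infinite, so the assignment is packed into one
    hypothesis. *)
Definition ConjVars X (hX : small (lambda C) X) (theta : X -> form C S unit) :
  form C S X := Conj (small_kappa hX) (fun x => at_ (theta x) x).

(** Since [f] may identify variables, the transfer goes through [nd_subst] and the smallness of
    [X]. *)
Lemma nd_rename_ConjVars X (hX : small (lambda C) X) theta a Y
    (l : seq (form C S Y)) (f : X -> Y) :
  nd [:: ConjVars hX theta] a -> (forall x, nd l (at_ (theta x) (f x))) ->
  nd l (rename f a).
Proof.
move=> h lf; apply: nd_cut (nd_subst hX (fun x => Var (f x)) h) => b /= [<-|//].
by apply: nd_conj => x; have := lf x; rewrite -rename_at.
Qed.

Lemma nd_ConjVars X (hX : small (lambda C) X) theta a (l : seq (form C S X)) :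
  nd [:: ConjVars hX theta] a -> (forall x, nd l (at_ (theta x) x)) -> nd l a.
Proof.
by move=> h lx; have := nd_rename_ConjVars h lx; rewrite /rename subst_id.
Qed.

Definition either X Y Z (f : X -> Z) (g : Y -> Z) (v : X + Y) : Z :=
  match v with inl x => f x | inr y => g y end.

Definition decides X (phi : form C S X) : Prop :=
  forall (hX : small (lambda C) X) (theta : X -> form C S unit),
    (forall x, Theta (theta x)) ->
    nd [:: ConjVars hX theta] (relativize U phi) \/
    nd [:: ConjVars hX theta] (Neg (relativize U phi)).

Lemma decides_atomic X (phi : form C S X) : atomic phi -> decides phi.
Proof.
move=> phi_at hX theta Th.
have -> : relativize U phi = phi by case: phi phi_at.
have [n [phi' [g [phi'_at ->]]]] := atomic_fin_supported phi_at.
have lg i : nd [:: ConjVars hX theta] (at_ (theta (g i)) (g i)).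
  exact: nd_conjE (nd_head).
have [h|h] := @nd_atomic n phi'
  (fun i => theta (g i)) phi'_at (fun i => Th (g i)); [left|right]; exact: h.
Qed.

(** Joint witnesses of [theta'] lie in [U], so the guarded universal formula would yield the refuted
    instance. *)
Lemma decides_all_neg X I (hI : small (lambda C) I) (phi : form C S (X + I))
    hX hXI (theta : X -> form C S unit) (theta' : I -> form C S unit) :
  (forall i, Theta (theta' i)) ->
  nd [:: ConjVars hXI (either theta theta')]
    (Neg (relativize U phi)) ->
  nd [:: ConjVars hX theta] (Neg (relativize U (All hI phi))).
Proof.
move=> Th' h; set A := relativize U (All hI phi).
apply: (nd_neg A); first exact: nd_head.
  apply: (nd_joint hI Th') => l' ll' lth.
  have lA : nd l' (rename inl A) by apply/nd_hyp/ll'; left.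
  have lG : nd l' (rename inl (ConjVars hX theta)).
    by apply/nd_hyp/ll'; right; left.
  have lN : nd l' (Neg (relativize U phi)).
    apply: nd_ConjVars h _ => -[x|i]; last exact: lth.
    by have := nd_conjE x lG; rewrite -/subst subst_at.
  apply: nd_absurd lN; apply: (nd_mp (nd_allE_inl lA)); apply: nd_conj => i.
  exact: (nd_in_U (Th' i) (lth i)).
Qed.

(** The restriction rule infers only sentences, hence the free variables are bound together with the
    block and their assignment becomes a premise. *)
Lemma prov_all_guarded X I (hI : small (lambda C) I) (phi : form C S (X + I))
    (hX : small (lambda C) X) (hXI : small (lambda C) (X + I))
    (theta : X -> form C S unit) :
  (forall x, Theta (theta x)) ->
  (forall theta' : I -> form C S unit, (forall i, Theta (theta' i)) ->
     nd [:: ConjVars hXI (either theta theta')]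
       (relativize U phi)) ->
  prov R T (relativize U
    (All hXI (rename (@inr void (X + I))
       (Imp (rename inl (ConjVars hX theta)) phi)))).
Proof.
move=> Th h; set psi := Imp _ phi.
apply: prov_rule (Restriction Theta U hXI _) _ => _ [theta2 Th2 ->].
apply: prov_nd; set chi := And _ _.
set B := All hXI (Imp (Conj (small_kappa hXI) (fun v => holds C U (inr v)))
  (Neg (relativize U chi))).
rewrite -[relativize U _]/(Neg B).
apply: (nd_neg B); first exact: nd_head.
apply: (nd_joint hXI Th2) => l' ll' lth.
have lU v : nd l' (holds C U (inr v)) by exact: (nd_in_U (Th2 v) (lth v)).
have lB : nd l' (rename inl B) by apply/nd_hyp/ll'; left.
have lN : nd l' (Neg (relativize U chi)).
  by apply: (nd_mp (nd_allE_inl lB)); exact: nd_conj.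
apply: nd_absurd lN; rewrite relativize_and; apply: nd_and.
  apply: nd_conj => v.
  suff: nd l' (relativize U (at_ (theta2 v) (inr v))) by [].
  rewrite relativize_at; exact/(nd_absolute (Th2 v) (lU v))/lth.
have -> : relativize U (rename (@inr void (X + I)) psi) =
    Imp (rename inr (rename inl (relativize U (ConjVars hX theta))))
        (rename inr (relativize U phi)).
  by rewrite /rename -!relativize_subst.
apply: nd_imp.
(* Either the members chosen for the free variables entail the [theta x], and [h] applies; or, by
   [nd_compare], one of them excludes [theta x], and the premise just assumed is contradictory. *)
have [same|/existsNP[x diff]] := pselect (forall x Y (l : seq (form C S Y)) y,
    nd l (at_ (theta2 (inl x)) y) -> nd l (at_ (theta x) y)).
  have {}h := h (fun i => theta2 (inr i)) (fun i => Th2 _).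
  apply/nd_cons/(nd_rename_ConjVars h).
  by move=> [x|i]; [apply: same|]; exact: lth.
have [//|differ] := nd_compare (Th x) (Th2 (inl x)).
apply: nd_absurd (nd_cons _ (differ _ _ _ (lth (inl x)))).
apply/(nd_absolute (Th x)); first exact/nd_cons/lU.
rewrite -2!rename_at -relativize_at.
exact: nd_conjE x (nd_head).
Qed.

(** The sentence from [prov_all_guarded] is instantiated at the variables themselves; its guards and
    its premise remain to be discharged. *)
Lemma decides_all_pos X I (hI : small (lambda C) I) (phi : form C S (X + I))
    (hX : small (lambda C) X) (hXI : small (lambda C) (X + I))
    (theta : X -> form C S unit) :
  (forall x, Theta (theta x)) ->
  (forall theta' : I -> form C S unit, (forall i, Theta (theta' i)) ->
     nd [:: ConjVars hXI (either theta theta')]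
       (relativize U phi)) ->
  nd [:: ConjVars hX theta] (relativize U (All hI phi)).
Proof.
move=> Th h; have /= hp := prov_all_guarded hI hX Th h.
apply: nd_all; apply: nd_imp => /=; set l := [:: _ ; _].
have block_Var (a : form C S (X + I)) : subst (block Var) (rename inr a) = a.
  by rewrite subst_subst /= -[RHS]subst_id.
have lE : nd l (Imp (Conj (small_kappa hXI) (fun v => holds C U v))
    (Imp (rename inl (relativize U (ConjVars hX theta))) (relativize U phi))).
  have := nd_closed_all l Var hp.
  rewrite -[X in _ -> nd l (Imp _ (Imp X _))]relativize_subst.
  rewrite -[X in _ -> nd l (Imp _ X)]/(relativize U
    (Imp (rename inl (ConjVars hX theta)) phi)).
  rewrite -[X in _ -> nd l (Imp _ (relativize U X))]block_Var.
  rewrite [X in _ -> nd l (Imp _ X)]relativize_subst.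
  exact: id.
have lG x : nd l (at_ (theta x) (inl x)).
  rewrite -rename_at.
  have : nd l (Conj (small_kappa hX) (fun x => rename inl (at_ (theta x) x))).
    by apply: nd_hyp; right; left.
  exact: (nd_conjE x).
(* Free variables lie in [U] by their formulas in [Theta], bound ones by the guard just assumed. *)
have lU : forall v, nd l (holds C U v).
  move=> [x|i]; first exact: (nd_in_U (Th x) (lG x)).
  exact: nd_conjE i (nd_head).
apply: nd_mp; first by apply: nd_mp lE _; exact: nd_conj.
apply: nd_conj => x.
suff: nd l (rename inl (relativize U (at_ (theta x) x))) by [].
rewrite relativize_at rename_at.
exact/(nd_absolute (Th x) (lU _))/lG.
Qed.

Lemma decidesP X (phi : form C S X) : decides phi.
Proof.
elim: phi => {X} [X t u|X R ts|X a IHa|X a IHa b IHb|X J hJ a IHa|X I hI a IHa].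
- exact: decides_atomic.
- exact: decides_atomic.
- move=> hX theta Th; have [h|h] := IHa hX theta Th; [right|by left].
  apply: nd_neg (nd_head).
  exact: nd_cons h.
- move=> hX theta Th /=; have [ha|ha] := IHa hX theta Th; last first.
    by left; apply: nd_imp; apply: nd_absurd (nd_head) (nd_cons _ ha).
  have [hb|hb] := IHb hX theta Th; first by left; exact: nd_K.
  right; apply: (nd_neg (relativize U b)); last exact: nd_cons.
  by apply: nd_mp (nd_head) _; exact: nd_cons.
- move=> hX theta Th /=.
  have [h|/existsNP[i ni]] :=
      pselect (forall i, nd [:: ConjVars hX theta] (relativize U (a i))).
    by left; exact: nd_conj.
  right; have [//|h] := IHa i hX theta Th.
  apply: (nd_neg (relativize U (a i))); last exact: nd_cons.
  exact: nd_conjE (nd_head).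
- move=> hX theta Th.
  (* The induction hypothesis concerns the scope [X + I], which must again be small. *)
  have hXI := small_sum (@lambda_infinite C) hX hI.
  have [h|/existsNP[theta' /not_implyP[Th' nh]]] := pselect (
      forall theta' : I -> form C S unit, (forall i, Theta (theta' i)) ->
      nd [:: ConjVars hXI (either theta theta')]
        (relativize U a)).
    by left; exact: decides_all_pos h.
  have Th2 v : Theta (either theta theta' v).
    by case: v => [x|i]; [exact: Th|exact: Th'].
  have [//|h] := IHa hXI _ Th2.
  by right; exact: decides_all_neg Th' h.
Qed.

End Completeness.

Theorem theorem5 (C : cardinals) (S : signature) (T : form C S void -> Prop)
  (Theta : form C S unit -> Prop) (U : rsym S) (hU : rarity U = 1)
  (unique : forall theta, Theta theta -> uniqueness T theta)
  (in_U : forall theta, Theta theta ->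
     basic T (X := void)
       (All1 (Imp (at_ theta (inr tt)) (holds C U (inr tt)))))
  (decided : forall n (phi : form C S (void + 'I_n)), atomic phi ->
     forall theta : 'I_n -> form C S unit, (forall i, Theta (theta i)) ->
     basic T (bar phi theta) \/ basic T (Neg (bar phi theta)))
  (theta_absolute : forall theta, Theta theta -> absolute T U theta)
  (joint_existence : forall (I : Type) (hI : small (lambda C) I),
     infinite_set [set: I]%classic ->
     forall theta : I -> form C S unit, (forall i, Theta (theta i)) ->
     basic T (X := void) (Ex hI (ConjAt hI theta)))
  (sigma : form C S void) :
  restricted Theta U T (relativize U sigma) \/
  restricted Theta U T (Neg (relativize U sigma)).
Proof.
(* Over [void] the assignment is an empty conjunction, hence provable. *)
have close a : nd (restriction_rule Theta U) T
    [:: ConjVars (small_fin C void) (of_void _)] a ->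
    restricted Theta U T a.
  move=> h; apply: prov_nd; apply: nd_ConjVars h _; case.
have D : decides T Theta U sigma by exact: decidesP.
have [[]|h|h] := D (small_fin C void) (of_void _); [left|right].
  exact: close.
exact: close.
Qed.
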